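(* Let $\alpha\in(0,2)$, $b>0$, $d\ge 0$, $\varepsilon>0$, and let $D=(-b,b)$. Let $f:\mathbb{R}\to\mathbb{R}$ be an odd function that satisfies a Lipschitz condition and a linear growth condition. For $\beta\in[-1,1]$ let $u_\beta$ denote the mean first exit time from $D$ of the solution of the SDE ${\rm d}X_t=f(X_t)\,{\rm d}t+{\rm d}L_t$, $X_0=x$, driven by the asymmetric Lévy process $L_t$ with skewness parameter $\beta$; equivalently, $u_\beta$ is the solution of the nonlocal equation $$\frac d2 u''(x)+c_\beta(x)u'(x)+\varepsilon\int_{\mathbb{R}\setminus\{0\}}\big[u(x+y)-u(x)-1_{\{|y|<b\}}(y)\,y\,u'(x)\big]\,\nu_{\alpha,\beta}({\rm d}y)=-1,\qquad x\in D,$$ with exterior condition $u(x)=0$ for $x\in D^c$. Then for every $\beta\in[-1,1]$, $$u_{-\beta}(-x)=u_\beta(x)\qquad\text{for all }x\in(-b,b).$$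
   Context: Constants and jump measure. For $\alpha\in(0,2)$ and $\beta\in[-1,1]$, set $C_\alpha=\frac{\alpha(1-\alpha)}{\Gamma(2-\alpha)\cos(\pi\alpha/2)}$ if $\alpha\ne1$ and $C_\alpha=\frac2\pi$ if $\alpha=1$. Put $C_1=C_\alpha\frac{1+\beta}{2}$ and $C_2=C_\alpha\frac{1-\beta}{2}$. The jump measure on $\mathbb{R}\setminus\{0\}$ is $$\nu_{\alpha,\beta}({\rm d}y)=\frac{C_1 1_{\{0<y<\infty\}}(y)+C_2 1_{\{-\infty<y<0\}}(y)}{|y|^{1+\alpha}}\,{\rm d}y.$$ Set $K_{\alpha,\beta}=\frac{C_1-C_2}{1-\alpha}$ if $\alpha\neq1$, and $$K_{1,\beta}=\Big(\int_1^\infty\frac{\sin x}{x^2}\,{\rm d}x+\int_0^1\frac{\sin x-x}{x^2}\,{\rm d}x\Big)(C_2-C_1)\quad\text{if }\alpha=1.$$ The SDE and its generator. The constants $d$ and $\varepsilon$ are the intensities of the Gaussian and Lévy noises. $L_t$ is the one-dimensional Lévy process (Gaussian part of variance $d$, jump measure $\varepsilon\nu_{\alpha,\beta}$, and drift $\varepsilon K_{\alpha,\beta}$ relative to the truncation function $1_{\{|y|<1\}}$) such that the solution $X_t$ of ${\rm d}X_t=f(X_t)\,{\rm d}t+{\rm d}L_t$, $X_0=x$, has generator $$\mathscr{L}\varphi(x)=(f(x)+\varepsilon K_{\alpha,\beta})\varphi'(x)+\frac d2\varphi''(x)+\varepsilon\int_{\mathbb{R}\setminus\{0\}}\big(\varphi(x+y)-\varphi(x)-1_{\{|y|<1\}}(y)\,y\,\varphi'(x)\big)\,\nu_{\alpha,\beta}({\rm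 d}y).$$ Mean first exit time. The first exit time from $D$ is $\tau=\inf\{t\ge0: X_t\notin D\}$ for the process started at $X_0=x$, and the mean first exit time is $u(x)=\mathbb{E}[\tau]$. It satisfies $\mathscr{L}u=-1$ in $D$ and $u=0$ on $D^c$. Replacing the truncation $1_{\{|y|<1\}}$ by $1_{\{|y|<b\}}$ turns $\mathscr{L}u=-1$ into the equation in the claim, where $$c_\beta(x)=f(x)+\varepsilon K_{\alpha,\beta}+\varepsilon(C_1-C_2)\frac{b^{1-\alpha}-1}{1-\alpha}\quad(\alpha\ne1),\qquad c_\beta(x)=f(x)+\varepsilon K_{\alpha,\beta}+\varepsilon(C_1-C_2)\ln b\quad(\alpha=1).$$ Convention. The solution of this exterior-value problem is understood to be unique and is identified with the mean first exit time. *)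

(* Defs.v *)
From HB Require Import structures.
From mathcomp Require Import all_boot all_order all_algebra.
From mathcomp Require Import all_classical all_reals all_analysis.

Set Implicit Arguments.
Unset Strict Implicit.
Unset Printing Implicit Defensive.

Import Order.TTheory GRing.Theory Num.Theory.
Import numFieldNormedType.Exports.

Local Open Scope classical_set_scope.
Local Open Scope ring_scope.

Section constants.
Context {R : realType}.
Implicit Types alpha beta b eps x y z : R.

Definition Gamma z : R :=
  \int[lebesgue_measure]_(t in `]0, +oo[) (t `^ (z - 1) * expR (- t)).

Definition Calpha alpha : R :=
  if alpha == 1 then 2 / pi
  else alpha * (1 - alpha) / (Gamma (2 - alpha) * cos (pi * alpha / 2)).

Definition C1 alpha beta : R := Calpha alpha * ((1 + beta) / 2).
Definition C2 alpha beta : R := Calpha alpha * ((1 - beta) / 2).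

Definition Kdrift alpha beta : R :=
  if alpha == 1 then
    (\int[lebesgue_measure]_(x in `[1, +oo[) (sin x / x ^+ 2)
     + \int[lebesgue_measure]_(x in `]0, 1]) ((sin x - x) / x ^+ 2))
    * (C2 alpha beta - C1 alpha beta)
  else (C1 alpha beta - C2 alpha beta) / (1 - alpha).

(* Lebesgue density of the jump measure nu_{alpha,beta} on R \ {0}. *)
Definition jump_density alpha beta y : R :=
  (C1 alpha beta * (0 < y)%R%:R + C2 alpha beta * (y < 0)%R%:R)
  / `|y| `^ (1 + alpha).

Definition jump_int alpha beta (g : R -> R) : R :=
  \int[lebesgue_measure]_(y in [set y : R | y != 0])
    (g y * jump_density alpha beta y).

Definition jump_integrable alpha beta (g : R -> R) : Prop :=
  lebesgue_measure.-integrable [set y : R | y != 0]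
    (fun y => (g y * jump_density alpha beta y)%:E).

(* Convection coefficient c_beta, after changing the truncation from
   |y| < 1 to |y| < b. *)
Definition cdrift alpha eps (f : R -> R) b beta x : R :=
  f x + eps * Kdrift alpha beta
  + eps * (C1 alpha beta - C2 alpha beta)
    * (if alpha == 1 then ln b else (b `^ (1 - alpha) - 1) / (1 - alpha)).

(* Real and imaginary parts of the Levy-Khintchine exponent of the triplet
   (Gaussian variance d, jump measure eps * nu, drift eps * K), relative to
   the truncation function 1_{|y| < 1}. *)
Definition psi_re alpha d eps beta (xi : R) : R :=
  - (d / 2) * xi ^+ 2
  + eps * jump_int alpha beta (fun y => cos (xi * y) - 1).

Definition psi_im alpha eps beta (xi : R) : R :=
  eps * Kdrift alpha beta * xi
  + eps * jump_int alpha beta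
      (fun y => sin (xi * y) - (`|y| < 1)%R%:R * (xi * y)).

Definition linear_growth (f : R -> R) : Prop :=
  exists k : R, forall x : R, `|f x| <= k * (1 + `|x|).

(* Paths are functions on R of which only the restriction to [0, +oo[ is
   relevant. *)
Definition cadlag (w : R -> R) : Prop :=
  (forall t : R, 0 <= t -> w s @[s --> t^'+] --> w t) /\
  (forall t : R, 0 < t -> cvg (w s @[s --> t^'-])).

(* Equal to +oo if the path never leaves ]-b, b[. *)
Definition exit_time b (w : R -> R) : \bar R :=
  ereal_inf [set t%:E | t in [set t : R | 0 <= t /\ ~ (- b < w t < b)]].

End constants.

Section process.
Context {R : realType} {disp : measure_display} {Omega : measurableType disp}.
Variable P : probability Omega R.

(* The process L is indexed by time; its law is determined by the
   characteristic function E[exp(i xi L_t)] = exp(t psi(xi)), written here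
   through its real and imaginary parts. *)
Record levy_process (alpha d eps beta : R) (L : R -> Omega -> R) : Prop := {
  levy_measurable : forall t : R, 0 <= t -> measurable_fun setT (L t) ;
  levy_start : {ae P, forall w, L 0 w = 0} ;
  levy_cadlag : {ae P, forall w, cadlag (L ^~ w)} ;
  levy_independent : forall (n : nat) (t : nat -> R) (A : nat -> set R),
    0 <= t 0%N -> (forall i, t i <= t i.+1) -> (forall i, measurable (A i)) ->
    let B i := [set w | A i (L (t i.+1) w - L (t i) w)] in
    P (\bigcap_(i in `I_n) B i) = (\prod_(i < n) P (B i))%E ;
  levy_stationary : forall (s h : R) (A : set R),
    0 <= s -> 0 <= h -> measurable A ->
    P [set w | A (L (s + h) w - L s w)] = P [set w | A (L h w)] ;
  levy_char_re : forall t xi : R, 0 <= t ->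
    'E_P[fun w => cos (xi * L t w)]%E =
    (expR (t * psi_re alpha d eps beta xi)
     * cos (t * psi_im alpha eps beta xi))%:E ;
  levy_char_im : forall t xi : R, 0 <= t ->
    'E_P[fun w => sin (xi * L t w)]%E =
    (expR (t * psi_re alpha d eps beta xi)
     * sin (t * psi_im alpha eps beta xi))%:E
}.

(* dX = f(X) dt + dL, X_0 = x.  The noise is additive, so the equation is
   pathwise and involves no stochastic integral. *)
Record sde_solution (f : R -> R) (L : R -> Omega -> R) (x : R)
    (X : R -> Omega -> R) : Prop := {
  sde_measurable : forall t : R, 0 <= t -> measurable_fun setT (X t) ;
  sde_cadlag : {ae P, forall w, cadlag (X ^~ w)} ;
  sde_eq : {ae P, forall w, forall t : R, 0 <= t ->
    X t w = x + (\int[lebesgue_measure]_(s in `[0, t]) f (X s w)) + L t w}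
}.

(* The integral of a nonnegative function is the supremum of the integrals of
   the measurable simple functions below it; hence this is the usual
   expectation even when the exit time is only measurable for the
   P-completion of the sigma-algebra. *)
Definition mean_exit (b : R) (X : R -> Omega -> R) : \bar R :=
  (\int[P]_w exit_time b (X ^~ w))%E.

End process.

Section exit_problem.
Context {R : realType}.
Implicit Types (alpha b d eps beta : R) (f u : R -> R).

(* The mean first exit time depends only on the law of the noise and not on
   the probability space carrying it: u is the mean exit time if the SDE is
   solvable from every starting point for some Levy process with the
   prescribed triplet, and every such solution has mean exit time u x. *)
Definition mean_first_exit_time alpha b d eps f beta u : Prop :=
  (exists (disp : measure_display) (Omega : measurableType disp)
      (P : probability Omega R) (L : R -> Omega -> R)
      (X : R -> R -> Omega -> R),
    levy_process P alpha d eps beta L /\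
    forall x, sde_solution P f L x (X x)) /\
  (forall (disp : measure_display) (Omega : measurableType disp)
      (P : probability Omega R) (L : R -> Omega -> R) (x : R)
      (X : R -> Omega -> R),
    levy_process P alpha d eps beta L -> sde_solution P f L x X ->
    mean_exit P b X = (u x)%:E).

Definition compensated_increment b u (x y : R) : R :=
  u (x + y) - u x - (`|y| < b)%R%:R * (y * derive1 u x).

(* Classical solutions.  Continuity across the boundary of D is part of the
   notion: without it, solutions with a jump at -b or b destroy uniqueness.
   The second derivative is required to exist only when it appears in the
   equation, that is, when d is nonzero. *)
Record exit_problem_solution alpha b d eps f beta u : Prop := {
  exit_continuous : continuous u ;
  exit_outside : forall x : R, ~ (- b < x < b) -> u x = 0 ;
  exit_derivable : forall x : R, - b < x < b -> derivable u x 1 ;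
  exit_derivable2 : d != 0 ->
    forall x : R, - b < x < b -> derivable (derive1 u) x 1 ;
  exit_integrable : forall x : R, - b < x < b ->
    jump_integrable alpha beta (compensated_increment b u x) ;
  exit_eq : forall x : R, - b < x < b ->
    d / 2 * derive1n 2 u x + cdrift alpha eps f b beta x * derive1 u x
    + eps * jump_int alpha beta (compensated_increment b u x) = -1
}.

Definition unique_exit_problem_solution alpha b d eps f beta u : Prop :=
  exit_problem_solution alpha b d eps f beta u /\
  forall v, exit_problem_solution alpha b d eps f beta v -> v = u.

End exit_problem.

(* Main.v *)
Require Import Defs.
From HB Require Import structures.
From mathcomp Require Import all_boot all_order all_algebra.
From mathcomp Require Import all_classical all_reals all_analysis.
From mathcomp Require Import ring.
From mathcomp Require Import measurable_realfun.

Set Implicit Arguments.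
Unset Strict Implicit.
Unset Printing Implicit Defensive.

Import Order.TTheory GRing.Theory Num.Theory.
Import numFieldNormedType.Exports.

Local Open Scope classical_set_scope.
Local Open Scope ring_scope.

(** Everything is invariant under the reflection [x |-> - x], which exchanges
    the constants [C1] and [C2], that is, turns the skewness [beta] into
    [- beta].

    At the level of coefficients, the jump density satisfies
    [jump_density (- beta) y = jump_density beta (- y)], and Lebesgue measure is
    invariant under [y |-> - y]; hence jump integrals for [- beta] are jump
    integrals for [beta] of the reflected integrand
    ([jump_int_reflect]).  The drift constants are odd in [C1 - C2], so that
    they change sign; since [f] is odd, so does the convection coefficient
    ([cdriftN]).

    For the mean exit time, the real part of the Levy exponent is unchanged
    and the imaginary part changes sign, which is what conjugating the
    characteristic function does: if [L] is the noise for [beta], then [- L] is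
    a noise for [- beta] ([levy_processN]).  As [f] is odd, [- X] solves the
    equation driven by [- L] and started at [- x] ([sde_solutionN]).  The paths
    [X] and [- X] leave the symmetric interval at the same time, so the two
    mean exit times agree.

    For the exterior-value problem, [x |-> u (- x)] solves the problem for
    [- beta] whenever [u] solves it for [beta]
    ([exit_problem_solution_opp]): the second-order term is even, and in the
    first-order term both [u'] and the convection coefficient change sign.
    Uniqueness then identifies this function with [u_{- beta}]. *)

(** * Reflection and sign change in integrals *)

Section integral_opp.
Context {R : realType}.
Local Notation mu := (@lebesgue_measure R).

(** The image of Lebesgue measure under [-%R] is itself; the transfer formula for
    nonnegative functions applies to the positive and the negative part. *)
Lemma integral_opp (D : set R) (g : R -> \bar R) :
  measurable D -> -%R @^-1` D = D -> measurable_fun D g ->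
  (\int[mu]_(y in D) g (- y)%R = \int[mu]_(y in D) g y)%E.
Proof.
move=> mD DN mg.
have ge0_case (h : R -> \bar R) : measurable_fun D h ->
    (forall y, 0 <= h y)%E ->
    (\int[mu]_(y in D) h (- y)%R = \int[mu]_(y in D) h y)%E.
  move=> mh h0.
  have := @ge0_integral_pushforward _ _ (measurableTypeR R)
    (measurableTypeR R) R -%R (@oppr_measurable R setT) mu D h mD mh (fun y _ => h0 y).
  rewrite DN => <-.
  by apply: eq_measure_integral => A mA _; exact: lebesgue_measureN.
rewrite integralE [RHS]integralE; congr (_ - _)%E.
- rewrite -(ge0_case g^\+%E) //; last exact: measurable_funepos.
  by apply: eq_integral => y _; rewrite [in LHS](funepos_comp g).
- rewrite -(ge0_case g^\-%E) //; last exact: measurable_funeneg.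
  by apply: eq_integral => y _; rewrite [in LHS](funeneg_comp g).
Qed.

(** The sign change exchanges the integrals [p] and [q] of the positive and
    negative parts; when either is infinite the real-valued integral is 0 on
    both sides. *)
Lemma RintegralN d (T : measurableType d) (m : {measure set T -> \bar R})
    (D : set T) (g : T -> R) :
  \int[m]_(y in D) (- g y) = - \int[m]_(y in D) g y.
Proof.
rewrite /Rintegral; under eq_integral do rewrite EFinN.
rewrite integralE [in RHS]integralE.
have -> : (fun y => - (g y)%:E)%E^\+%E = (fun y => (g y)%:E)^\-%E
  by rewrite -funeposN.
have -> : (fun y => - (g y)%:E)%E^\-%E = (fun y => (g y)%:E)^\+%E
  by rewrite -funenegN.
have : (0 <= \int[m]_(y in D) (fun y => (g y)%:E)^\+ y)%E
  by exact: integral_ge0.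
have : (0 <= \int[m]_(y in D) (fun y => (g y)%:E)^\- y)%E
  by exact: integral_ge0.
move: (integral _ _ _) => q; move: (integral _ _ _) => p.
case: p q => [p| |] [q| |] //= _ _; rewrite ?opprB ?oppr0 //.
Qed.

End integral_opp.

(** * Coefficients and jump integrals under change of sign of the skewness *)

Section coefficients.
Context {R : realType}.
Implicit Types alpha beta b d eps x y : R.

Lemma C1N alpha beta : C1 alpha (- beta) = C2 alpha beta.
Proof. by []. Qed.

Lemma C2N alpha beta : C2 alpha (- beta) = C1 alpha beta.
Proof. by rewrite /C2 opprK. Qed.

Lemma KdriftN alpha beta : Kdrift alpha (- beta) = - Kdrift alpha beta.
Proof.
rewrite /Kdrift C1N C2N; move: (C1 _ _) (C2 _ _) => c1 c2; case: ifP => _.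
  by rewrite -mulrN opprB.
by rewrite -mulNr opprB.
Qed.

(** The sign on the right is what makes the first-order term of the generator
    invariant, the derivative of a reflected function changing sign too. *)
Lemma cdriftN alpha eps (f : R -> R) b beta x :
  (forall x, f (- x) = - f x) ->
  cdrift alpha eps f b (- beta) x = - cdrift alpha eps f b beta (- x).
Proof.
move=> fN; rewrite /cdrift C1N C2N KdriftN fN; move: (C1 _ _) (C2 _ _) => c1 c2.
by ring.
Qed.

Lemma jump_densityN alpha beta y :
  jump_density alpha (- beta) y = jump_density alpha beta (- y).
Proof.
by rewrite /jump_density C1N C2N normrN oppr_gt0 oppr_lt0 addrC.
Qed.

(** Needed to transport, by reflection, the jump integrals that define the
    Levy exponent. *)
Lemma measurable_jump_density alpha beta :
  measurable_fun setT (jump_density alpha beta).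
Proof.
have -> : jump_density alpha beta = (fun y : R =>
    (C1 alpha beta * \1_`]0, +oo[ y + C2 alpha beta * \1_`]-oo, 0[ y)
    * `|y| `^ (- (1 + alpha))).
  apply/funext => y; rewrite /jump_density powRN !indicE.
  congr ((_ * _%:R + _ * _%:R) * _).
    by rewrite mem_setE in_itv/= andbT.
  by rewrite mem_setE in_itv/=.
apply: measurable_funM.
  by apply: measurable_funD; apply: measurable_funM => //;
    exact: measurable_indic.
exact: (measurableT_comp (measurable_powR _)).
Qed.

Let punctured_line_measurable : measurable [set y : R | y != 0].
Proof.
rewrite (_ : [set y : R | y != 0] = ~` [set 0]); last first.
  by apply/seteqP; split=> y /= /eqP.
exact: measurableC.
Qed.

Let punctured_line_opp : -%R @^-1` [set y : R | y != 0] = [set y : R | y != 0].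
Proof. by apply/seteqP; split=> y /=; rewrite oppr_eq0. Qed.

Lemma jump_int_reflect alpha beta (g : R -> R) :
  measurable_fun [set y : R | y != 0]
    (fun y => g y * jump_density alpha beta y) ->
  jump_int alpha (- beta) (fun y => g (- y)) = jump_int alpha beta g.
Proof.
move=> mg; rewrite /jump_int /Rintegral; congr fine.
under eq_integral do rewrite jump_densityN.
apply: (integral_opp (g := fun y => (g y * jump_density alpha beta y)%:E)) => //.
exact/measurable_EFinP.
Qed.

Lemma jump_integrable_reflect alpha beta (g : R -> R) :
  jump_integrable alpha beta g ->
  jump_integrable alpha (- beta) (fun y => g (- y)).
Proof.
rewrite /jump_integrable; set h := (fun y => (g y * _)%:E) => /integrableP[mh fh].
have -> : (fun y => (g (- y) * jump_density alpha (- beta) y)%:E) =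
    (fun y => h (- y)).
  by apply/funext => y; rewrite jump_densityN.
apply/integrableP; split.
  apply: (measurable_comp punctured_line_measurable _ mh) => //.
  by move=> _ [y /= y0 <-]; rewrite oppr_eq0.
by rewrite (integral_opp (g := fun y => `|h y|%E)) //; exact: measurableT_comp.
Qed.

Lemma jump_int_oppr alpha beta (g : R -> R) :
  jump_int alpha beta (fun y => - g y) = - jump_int alpha beta g.
Proof.
by rewrite /jump_int -RintegralN; apply: eq_Rintegral => y _; rewrite mulNr.
Qed.

(** The next two lemmas say that the Levy exponent for [- beta] is the complex
    conjugate of the one for [beta]. *)
Lemma psi_reN alpha d eps beta (xi : R) :
  psi_re alpha d eps (- beta) xi = psi_re alpha d eps beta xi.
Proof.
rewrite /psi_re -(@jump_int_reflect _ beta).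
  by under [in RHS]eq_fun do rewrite mulrN cosN.
apply: measurable_funTS; apply: measurable_funM;
  last exact: measurable_jump_density.
apply: measurable_funB => //.
apply: continuous_measurable_fun => y.
by apply: continuous_comp; [exact: mulrl_continuous|exact: continuous_cos].
Qed.

Lemma psi_imN alpha eps beta (xi : R) :
  psi_im alpha eps (- beta) xi = - psi_im alpha eps beta xi.
Proof.
rewrite /psi_im KdriftN mulrN mulNr opprD; congr (_ + _).
rewrite -mulrN -jump_int_oppr -(@jump_int_reflect _ beta).
  congr (_ * jump_int _ _ _); apply/funext => y.
  by rewrite normrN mulrN sinN mulrN -opprD opprK.
apply: measurable_funTS; apply: measurable_funM;
  last exact: measurable_jump_density.
apply: measurable_funN; apply: measurable_funB => //.
  apply: continuous_measurable_fun => y.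
  by apply: continuous_comp; [exact: mulrl_continuous|exact: continuous_sin].
apply: measurable_funM; last exact: measurable_funM.
rewrite (_ : (fun y : R => (`|y| < 1)%R%:R) = \1_`]-1, 1[).
  exact: measurable_indic.
by apply/funext => y; rewrite indicE mem_setE in_itv/= ltr_norml.
Qed.

End coefficients.

(** * The reflected process *)

Section process.
Context {R : realType}.

Lemma cadlagN (w : R -> R) : cadlag w -> cadlag (fun t => - w t).
Proof.
move=> [wr wl]; split=> t t0; first exact: cvgN (wr t t0).
by apply: is_cvgN; exact: wl.
Qed.

Lemma exit_timeN (b : R) (w : R -> R) :
  exit_time b (fun t => - w t) = exit_time b w.
Proof.
rewrite /exit_time; congr ereal_inf; apply/seteqP.
by split=> _ [t [t0 wt] <-]; exists t => //; split=> //;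
  move: wt; rewrite ltrN2 ltrNl andbC.
Qed.

Context {disp : measure_display} {Omega : measurableType disp}.
Variable P : probability Omega R.

(** A finite value excludes the indeterminate form [+oo - oo], which is [-oo] by
    convention and therefore not odd. *)
Lemma expectationN (Y : Omega -> R) (r : R) :
  'E_P[Y]%E = r%:E -> 'E_P[fun w => (- Y w)%R]%E = (- r)%:E.
Proof.
rewrite unlock => EY; under eq_integral do rewrite EFinN.
rewrite integralN ?EY //.
rewrite integralE in EY; move: EY.
move: (integral _ _ _) => p; move: (integral _ _ _) => q.
by case: p q => [p| |] [q| |].
Qed.

(** The increments of [- L] fall in [A] exactly when those of [L] fall in the
    reflection of [A]; the characteristic function is conjugated, and so is the
    exponent. *)
Lemma levy_processN (alpha d eps beta : R) (L : R -> Omega -> R) :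
  levy_process P alpha d eps beta L ->
  levy_process P alpha d eps (- beta) (fun t w => - L t w).
Proof.
have BN (X Y : Omega -> R) (A : set R) :
    [set w | A (- X w - - Y w)] = [set w | (-%R @^-1` A) (X w - Y w)].
  by apply/seteqP; split=> w /=; rewrite opprD.
have mN (A : set R) : measurable A -> measurable (-%R @^-1` A).
  by move=> mA; rewrite -[X in measurable X]setTI; exact: oppr_measurable.
move=> [mL L0 Lcadlag Lindep Lstat Lre Lim]; split.
- by move=> t t0; apply: measurable_funN; exact: mL.
- by apply: filterS L0 => w ->; rewrite oppr0.
- by apply: filterS Lcadlag => w; exact: cadlagN.
- move=> n t A t0 tS mA /=.
  under eq_bigcapr do rewrite BN.
  rewrite (Lindep n t (fun i => -%R @^-1` A i)) //; last by move=> i; exact: mN.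
  by apply: eq_bigr => i _; rewrite BN.
- by move=> s h A s0 h0 mA; rewrite BN (Lstat s h (-%R @^-1` A)) //; exact: mN.
- move=> t xi t0; rewrite psi_reN psi_imN mulrN cosN -Lre //.
  by congr expectation; apply/funext => w; rewrite mulrN cosN.
- move=> t xi t0; rewrite psi_reN psi_imN mulrN sinN mulrN.
  rewrite -(expectationN (Lim t xi t0)).
  by congr expectation; apply/funext => w; rewrite mulrN sinN.
Qed.

Lemma sde_solutionN (f : R -> R) (L : R -> Omega -> R) (x : R)
    (X : R -> Omega -> R) :
  (forall x, f (- x) = - f x) -> sde_solution P f L x X ->
  sde_solution P f (fun t w => - L t w) (- x) (fun t w => - X t w).
Proof.
move=> fN [mX Xcadlag eqX]; split.
- by move=> t t0; apply: measurable_funN; exact: mX.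
- by apply: filterS Xcadlag => w; exact: cadlagN.
- apply: filterS eqX => w eqX t t0.
  under eq_Rintegral do rewrite fN.
  by rewrite RintegralN eqX // !opprD.
Qed.

Lemma mean_exitN (b : R) (X : R -> Omega -> R) :
  mean_exit P b (fun t w => - X t w) = mean_exit P b X.
Proof. by apply: eq_integral => w _; exact: exit_timeN. Qed.

End process.

(** * The reflected exit problem *)

Section exit_problem.
Context {R : realType}.
Implicit Types (alpha b d eps beta : R) (f u : R -> R).

Lemma sym_itv_opp b (x : R) : (- b < - x < b) = (- b < x < b).
Proof. by rewrite ltrN2 ltrNl andbC. Qed.

Lemma is_derive_comp_opp u (x : R) : derivable u (- x) 1 ->
  is_derive x 1 (fun y => u (- y)) (- derive1 u (- x)).
Proof.
move=> du; rewrite -mulrN1 derive1E.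
exact: (is_derive1_comp (derivableP du) (is_deriveNid x 1)).
Qed.

Lemma derive1_comp_opp u (x : R) : derivable u (- x) 1 ->
  derive1 (fun y => u (- y)) x = - derive1 u (- x).
Proof. by move=> /is_derive_comp_opp [_ <-]; rewrite derive1E. Qed.

Lemma compensated_increment_opp b u (x y : R) : derivable u (- x) 1 ->
  compensated_increment b (fun z => u (- z)) x y =
  compensated_increment b u (- x) (- y).
Proof.
by move=> du; rewrite /compensated_increment derive1_comp_opp//
  normrN mulrN mulNr opprD.
Qed.

(** Term by term, the equation for [x |-> u (- x)] at [x] is the equation for
    [u] at [- x]. *)
Lemma exit_problem_solution_opp alpha b d eps f beta u :
  (forall x, f (- x) = - f x) ->
  exit_problem_solution alpha b d eps f beta u ->
  exit_problem_solution alpha b d eps f (- beta) (fun x => u (- x)).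
Proof.
move=> fN [uc u_out du d2u u_int u_eq].
have incr x : - b < x < b ->
    compensated_increment b (fun z => u (- z)) x =
    (fun y => compensated_increment b u (- x) (- y)).
  move=> xb; apply/funext => y; apply: compensated_increment_opp.
  by apply: du; rewrite sym_itv_opp.
(* The second derivative needs the identity between first derivatives on a
   neighbourhood of the point, which the open interval provides. *)
have duN x : - b < x < b -> \forall y \near x,
    - derive1 u (- y) = derive1 (fun z => u (- z)) y.
  move=> xb.
  have : x \in `]-b, b[ by rewrite in_itv.
  move/near_in_itvoo; apply: filterS => y; rewrite in_itv/= => yb.
  by rewrite derive1_comp_opp//; apply: du; rewrite sym_itv_opp.
have d2uN x : d != 0 -> - b < x < b ->
    is_derive x 1 (derive1 (fun z => u (- z))) (derive1 (derive1 u) (- x)).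
  move=> d0 xb; apply: near_eq_is_derive; first exact: duN.
  have -> : derive1 (derive1 u) (- x) = - - derive1 (derive1 u) (- x)
    by rewrite opprK.
  apply: is_deriveN; apply: is_derive_comp_opp.
  by apply: d2u => //; rewrite sym_itv_opp.
split.
- move=> x; apply: continuous_comp; [exact: oppr_continuous|exact: uc].
- by move=> x xb; apply: u_out; rewrite sym_itv_opp.
- move=> x xb; apply: ex_derive; apply: is_derive_comp_opp.
  by apply: du; rewrite sym_itv_opp.
- by move=> d0 x xb; have [] := d2uN x d0 xb.
- move=> x xb; rewrite incr//; apply: jump_integrable_reflect.
  by apply: u_int; rewrite sym_itv_opp.
- move=> x xb; have Nxb : - b < - x < b by rewrite sym_itv_opp.
  rewrite incr// jump_int_reflect; last first.
    by apply/measurable_EFinP; have /integrableP[] := u_int _ Nxb.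
  rewrite cdriftN// derive1_comp_opp ?mulrNN; last exact: du.
  have -> : d / 2 * derive1n 2 (fun z => u (- z)) x =
      d / 2 * derive1n 2 u (- x).
    (* When [d] is 0 the second derivatives need not exist, and only their common
       factor is used. *)
    have mul0_eq (p q : R) : 0 / 2 * p = 0 / 2 * q by rewrite !mul0r.
    have [->|d0] := eqVneq d 0; first exact: mul0_eq.
    rewrite !derive1nS !derive1n0 [in LHS]derive1E.
    by have [_ ->] := d2uN x d0 xb.
  exact: u_eq.
Qed.

End exit_problem.

(** * The symmetry of the mean exit time *)

Theorem proposition2p1 (R : realType) (alpha b d eps : R)
    (halpha : 0 < alpha < 2) (hb : 0 < b) (hd : 0 <= d) (heps : 0 < eps)
    (f : R -> R) (f_odd : forall x : R, f (- x) = - f x)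
    (f_lipschitz : [lipschitz f x | x in [set: R]])
    (f_growth : linear_growth f)
    (beta : R) (hbeta : -1 <= beta <= 1) (u : R -> R -> R) :
  (mean_first_exit_time alpha b d eps f beta (u beta) ->
   mean_first_exit_time alpha b d eps f (- beta) (u (- beta)) ->
   forall x : R, - b < x < b -> u (- beta) (- x) = u beta x) /\
  (unique_exit_problem_solution alpha b d eps f beta (u beta) ->
   unique_exit_problem_solution alpha b d eps f (- beta) (u (- beta)) ->
   forall x : R, - b < x < b -> u (- beta) (- x) = u beta x).
Proof.
split.
- move=> [[disp [T [P [L [X [LP XP]]]]]] mean] [_ meanN] x _.
  apply: EFin_inj.
  rewrite -(mean _ _ _ _ _ _ LP (XP x)).
  rewrite -(meanN _ _ _ _ _ _ (levy_processN LP) (sde_solutionN f_odd (XP x))).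
  exact: mean_exitN.
- move=> [solu _] [_ uniq] x _.
  by rewrite -(uniq _ (exit_problem_solution_opp f_odd solu)) opprK.
Qed.
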